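(* Let $\{B_i : i\in\mathbb{N}\}$ be an almost disjoint family of infinite subsets of $\mathbb{N}$. Let $S$ be the inverse subsemigroup of $I(\mathbb{N})$ generated by $\bigcup_{i\in\mathbb{N}}S_\infty(B_i)$. Then $$S=\bigcup_{i\in\mathbb{N}}S_\infty(B_i)\ \cup\ \bigcup_{i,j\in\mathbb{N}}\bigcup_{k=1}^{P_{i,j}}I_k(B_i,B_j)\ \cup\ \{1_\emptyset\}.$$
   Context: $\mathbb{N}$ denotes the non-negative integers. $I(\mathbb{N})$ is the set of all bijections $f:A\to B$ with $A,B\subseteq\mathbb{N}$ (including the empty function $1_\emptyset$); write $\mathrm{dom}(f)=A$, $\mathrm{im}(f)=B$. The operation is composition of partial functions: $\mathrm{dom}(f\circ g)=g^{-1}(\mathrm{dom}(f)\cap\mathrm{im}(g))$ and $(f\circ g)(x)=f(g(x))$. It is an inverse semigroup, the inverse of $f$ being the inverse function $f^{-1}:B\to A$. The inverse subsemigroup generated by a set is the smallest subset containing it and closed under composition and inversion. For $B\subseteq\mathbb{N}$, $S_\infty(B)$ is the group of all bijections from $B$ to $B$, viewed as a subset of $I(\mathbb{N})$. For $k\in\mathbb{N}$ and $A,B\subseteq\mathbb{N}$, $I_k(A,B)=\{f\in I(\mathbb{N}): \mathrm{dom}(f)\subseteq A,\ \mathrm{im}(f)\subseteq B,\ |\mathrm{dom}(f)|=k\}$. The family $\{B_i: i\in\mathbb{N}\}$ is almost disjoint if $B_i\cap B_j$ is finite for all $i\neq j$. For $m,i,j\in\mathbb{N}$, an $m$-chain between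 $B_i$ and $B_j$ is a tuple $(k_1,\dots,k_n)$ (of elements of $\mathbb{N}$, $n\geq 1$) such that $|B_i\cap B_{k_1}|\geq m$, $|B_{k_1}\cap B_{k_2}|\geq m$, ..., $|B_{k_{n-1}}\cap B_{k_n}|\geq m$, and $|B_{k_n}\cap B_j|\geq m$. The case $i=j$ is allowed, but then it is required that $i\neq k_1$. For $i,j\in\mathbb{N}$, $$P_{i,j}=\sup\{m\in\mathbb{N}: \text{there exists an } m\text{-chain between } B_i\text{ and }B_j\},$$ which may equal $\infty$ (in that case the union $\bigcup_{k=1}^{P_{i,j}}$ is over all integers $k\geq 1$). *)

(* Defs.v *)
From mathcomp Require Import all_boot all_order.
From mathcomp Require Import boolp classical_sets functions cardinality.

Set Implicit Arguments.
Unset Strict Implicit.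
Unset Printing Implicit Defensive.

Local Open Scope classical_set_scope.
Local Open Scope card_scope.

(* The inverse semigroup I(N): a bijection between two subsets of nat is encoded
   as an injective partial function, where [f x = None] means that [x] is not in
   the domain; the codomain of the bijection is the image of the function. *)
Record pinj := PInj {
  pfun :> nat -> option nat;
  pfun_inj : forall x y z, pfun x = Some z -> pfun y = Some z -> x = y
}.

Definition dom (f : pinj) : set nat := [set x | exists y, f x = Some y].
Definition im (f : pinj) : set nat := [set y | exists x, f x = Some y].

Lemma pinj_ext (f g : pinj) : f =1 g -> f = g.
Proof.
case: f g => [f fI] [g gI] /= /funext fg; move: fI gI; rewrite fg => fI gI.
by congr PInj; exact: Prop_irrelevance.
Qed.

Lemma pempty_inj (x y z : nat) : None = Some z -> None = Some z -> x = y.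
Proof. by []. Qed.

Definition pempty : pinj := @PInj (fun=> None) pempty_inj.

Lemma pcomp_inj (f g : pinj) x y z :
  pcomp f g x = Some z -> pcomp f g y = Some z -> x = y.
Proof.
rewrite /pcomp; case gx: (g x) => [a|//] /= fa; case gy: (g y) => [b|//] /= fb.
by move: gy; rewrite -(pfun_inj fa fb); exact: pfun_inj.
Qed.

(* [pmul f g] maps [x] to [f (g x)]. *)
Definition pmul (f g : pinj) : pinj := PInj (@pcomp_inj f g).

Definition pinv_fun (f : pinj) (y : nat) : option nat :=
  if pselect (im f y) is left fy then Some (sval (cid fy)) else None.

Lemma pinv_funE (f : pinj) x y : pinv_fun f y = Some x <-> f x = Some y.
Proof.
rewrite /pinv_fun; case: pselect => [fy|nfy]; last first.
  by split=> // fxy; case: nfy; exists x.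
case: cid => x' /= fx'y; split=> [[<-]//|fxy].
by rewrite (pfun_inj fx'y fxy).
Qed.

Lemma pinv_fun_inj (f : pinj) x y z :
  pinv_fun f x = Some z -> pinv_fun f y = Some z -> x = y.
Proof. by move=> /pinv_funE fzx /pinv_funE; rewrite fzx => -[]. Qed.

Definition pinv (f : pinj) : pinj := PInj (@pinv_fun_inj f).

Definition inv_subsemigroup (S : set pinj) : Prop :=
  (forall f g, S f -> S g -> S (pmul f g)) /\ (forall f, S f -> S (pinv f)).

Definition inv_subsemigroup_gen (G : set pinj) : set pinj :=
  smallest inv_subsemigroup G.

Definition Sinf (B : set nat) : set pinj := [set f | dom f = B /\ im f = B].

Definition Ik (k : nat) (A B : set nat) : set pinj :=
  [set f | [/\ dom f `<=` A, im f `<=` B & dom f #= `I_k]].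

Definition almost_disjoint (B : nat -> set nat) : Prop :=
  forall i j, i <> j -> finite_set (B i `&` B j).

(* The tuple (k_1, ..., k_n) is given as the sequence [k1 :: s], whose shape
   enforces n >= 1. *)
Definition is_chain (B : nat -> set nat) (m i j : nat) (ks : seq nat) : Prop :=
  if ks is k1 :: s then
    path (fun a b => `I_m #<= B a `&` B b) i (rcons (k1 :: s) j)
    /\ (i = j -> i <> k1)
  else False.

(* Supremum of a set of naturals in N + {oo}, with [None] standing for oo;
   the supremum of the empty set is 0. *)
Definition esup (M : set nat) : option nat :=
  if pselect (ubound M !=set0) then Some (supremum 0 M) else None.

Definition le_enat (k : nat) (p : option nat) : Prop :=
  if p is Some n then k <= n else True.

Definition chain_sup (B : nat -> set nat) (i j : nat) : option nat :=
  esup [set m | exists ks, is_chain B m i j ks].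

(* Main.v *)
(* For almost disjoint [B i], [B j], a product of partial injections only keeps
   points that pass through [B i `&` B j] at each change of index, so a product
   whose domain has m points yields an m-chain.  Conversely, permutations of
   [B i] move any finite subset of [B i] of at most [|B i `&` B k|] points into
   [B i `&` B k], whose identity is the product of those of [B i] and [B k].
   Conjugating by transpositions removes points from it, so all the idempotents
   on such subsets are generated; a bijection linked by a chain then factors
   into steps, each extending to a permutation of a single [B k]. *)
Require Import Defs.
From mathcomp Require Import all_boot all_order.
From mathcomp Require Import boolp classical_sets functions cardinality.
(* [classical_sets] has its own [pinv]; the one meant here is that of [Defs]. *)
Import Defs.

Set Implicit Arguments.
Unset Strict Implicit.
Unset Printing Implicit Defensive.

Local Open Scope classical_set_scope.
Local Open Scope card_scope.

(** * Partial injections and comparison of cardinals *)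

Lemma pinj_eqP (f g : pinj) :
  (forall x y, f x = Some y <-> g x = Some y) -> f = g.
Proof.
move=> fg; apply: pinj_ext => x; case fx: (f x) => [y|].
  by rewrite ((fg x y).1 fx).
by case gx: (g x) => [y|//]; move: fx; rewrite ((fg x y).2 gx).
Qed.

Lemma pmulE (f g : pinj) x z :
  pmul f g x = Some z <-> exists2 y, g x = Some y & f y = Some z.
Proof.
rewrite /= /pcomp; split=> [|[y -> //]].
by case gx: (g x) => [y|//] /= fy; exists y.
Qed.

Lemma dom_pinv (f : pinj) : dom (pinv f) = im f.
Proof. by apply/seteqP; split=> x [y /pinv_funE fy]; exists y => //; apply/pinv_funE. Qed.

Lemma im_pinv (f : pinj) : im (pinv f) = dom f.
Proof. by apply/seteqP; split=> x [y /pinv_funE fy]; exists y => //; apply/pinv_funE. Qed.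

Lemma card_le_pinj (h : pinj) (A C : set nat) :
  (forall x, A x -> exists2 y, C y & h x = Some y) -> A #<= C.
Proof.
(* The default [0] is never taken on [A], where [h] is defined. *)
move=> hAC; pose g x := odflt 0 (h x).
have gh x : A x -> h x = Some (g x).
  by move=> /hAC[y _ hx]; rewrite /g hx.
have gA : g @` A #= A.
  apply: inj_card_eq => x y; rewrite !inE => Ax Ay gxy.
  by apply: (@pfun_inj h _ _ (g x)); rewrite ?gh // gxy.
rewrite -(card_le_eql gA); apply: subset_card_le => _ [x Ax <-].
by have [y Cy] := hAC _ Ax; rewrite gh // => -[->].
Qed.

Lemma card_le_pinjP (A C : set nat) :
  A #<= C -> exists2 h : pinj, dom h = A & im h `<=` C.
Proof.
move=> /pcard_leP[f].
pose h x := if `[< A x >] then Some (f x) else None.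
have hE x y : h x = Some y <-> A x /\ f x = y.
  rewrite /h; case: asboolP => Ax; split=> //.
  - by move=> [].
  - by move=> [_ ->].
  - by move=> [].
have hI x y z : h x = Some z -> h y = Some z -> x = y.
  move=> /hE[Ax fx] /hE[Ay fy]; apply: (@inj _ _ _ f); rewrite ?inE //.
  exact: etrans fx (esym fy).
exists (PInj hI).
  by apply/seteqP; split=> [x [y /hE[]] //|x Ax]; exists (f x); apply/hE.
by move=> y [x /hE[Ax <-]]; apply: funS.
Qed.

Lemma card_dom_im (f : pinj) : dom f #= im f.
Proof.
rewrite card_eq_le; apply/andP; split.
  by apply: (@card_le_pinj f) => x [y fx]; exists y => //; exists x.
by apply: (@card_le_pinj (pinv f)) => y [x fx]; exists x; [exists y|exact/pinv_funE].
Qed.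

(** * Partial identities, the idempotents of the semigroup *)

Definition pid_fun (A : set nat) (x : nat) : option nat :=
  if `[< A x >] then Some x else None.

Lemma pid_funE A x y : pid_fun A x = Some y <-> A x /\ x = y.
Proof.
rewrite /pid_fun; case: asboolP => Ax; split=> //.
- by move=> [].
- by move=> [_ ->].
- by move=> [].
Qed.

Lemma pid_fun_inj A x y z :
  pid_fun A x = Some z -> pid_fun A y = Some z -> x = y.
Proof. by move=> /pid_funE[_ ->] /pid_funE[_ ->]. Qed.

Definition pid (A : set nat) : pinj := PInj (@pid_fun_inj A).

Lemma pidE A x y : pid A x = Some y <-> A x /\ x = y.
Proof. exact: pid_funE. Qed.

Lemma dom_pid A : dom (pid A) = A.
Proof.
by apply/seteqP; split=> [x [y /pidE[]] //|x Ax]; exists x; exact/pidE.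
Qed.

Lemma im_pid A : im (pid A) = A.
Proof.
by apply/seteqP; split=> [y [x /pidE[Ax <-]] //|x Ax]; exists x; exact/pidE.
Qed.

Lemma pmul_pid A C : pmul (pid A) (pid C) = pid (A `&` C).
Proof.
apply: pinj_eqP => x y; split=> [/pmulE[z /pidE[Cx <-] /pidE[Ax <-]]|].
  exact/pidE.
by move=> /pidE[[Ax Cx] <-]; apply/pmulE; exists x; exact/pidE.
Qed.

(** * Permutations of a set, transpositions, and extension of finite injections *)

Lemma Sinf_pid A : Sinf A (pid A).
Proof. by split; [exact: dom_pid|exact: im_pid]. Qed.

Lemma Sinf_dom A g x : Sinf A g -> A x -> exists2 y, A y & g x = Some y.
Proof.
move=> [dg ig]; rewrite -{1}dg => -[y gx]; exists y => //.
by rewrite -ig; exists x.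
Qed.

Lemma Sinf_mul A f g : Sinf A f -> Sinf A g -> Sinf A (pmul f g).
Proof.
move=> Sf Sg; have [df fi] := Sf; have [dg gi] := Sg.
split; apply/seteqP; split.
- by move=> x [z /pmulE[y gx fy]]; rewrite -dg; exists y.
- move=> x Ax; have [y Ay gx] := Sinf_dom Sg Ax; have [z _ fy] := Sinf_dom Sf Ay.
  by exists z; apply/pmulE; exists y.
- by move=> z [x /pmulE[y gx fy]]; rewrite -fi; exists y.
- move=> z Az; move: (Az); rewrite -{1}fi => -[y fy].
  have : A y by rewrite -df; exists z.
  by rewrite -{1}gi => -[x gx]; exists x; apply/pmulE; exists y.
Qed.

Lemma Sinf_inv A f : Sinf A f -> Sinf A (pinv f).
Proof. by move=> [df fi]; split; rewrite ?dom_pinv ?im_pinv. Qed.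

Definition swap (a b x : nat) : nat :=
  if x == a then b else if x == b then a else x.

Lemma swapK a b x : swap a b (swap a b x) = x.
Proof.
rewrite /swap; case: (eqVneq x a) => [->|xa]; first by rewrite eqxx; case: eqP.
case: (eqVneq x b) => [->|xb]; first by rewrite eqxx.
by rewrite (negbTE xa) (negbTE xb).
Qed.

Lemma swap_in (A : set nat) a b x : A a -> A b -> A x -> A (swap a b x).
Proof. by rewrite /swap; case: ifP => // _; case: ifP. Qed.

Definition pswap_fun (A : set nat) a b (x : nat) : option nat :=
  if `[< A x >] then Some (swap a b x) else None.

Lemma pswap_funE A a b x y :
  pswap_fun A a b x = Some y <-> A x /\ swap a b x = y.
Proof.
rewrite /pswap_fun; case: asboolP => Ax; split=> //.
- by move=> [].
- by move=> [_ ->].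
- by move=> [].
Qed.

Lemma pswap_inj A a b x y z :
  pswap_fun A a b x = Some z -> pswap_fun A a b y = Some z -> x = y.
Proof.
move=> /pswap_funE[_ xz] /pswap_funE[_ yz].
by rewrite -(swapK a b x) xz -yz swapK.
Qed.

Definition pswap A a b : pinj := PInj (@pswap_inj A a b).

Lemma pswapE A a b x y : pswap A a b x = Some y <-> A x /\ swap a b x = y.
Proof. exact: pswap_funE. Qed.

Lemma Sinf_swap (A : set nat) a b : A a -> A b -> Sinf A (pswap A a b).
Proof.
move=> Aa Ab; split; apply/seteqP; split.
- by move=> x [y /pswapE[]].
- by move=> x Ax; exists (swap a b x); apply/pswapE.
- by move=> y [x /pswapE[Ax <-]]; apply: swap_in.
- move=> y Ay; exists (swap a b y); apply/pswapE; split; last exact: swapK.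
  exact: swap_in.
Qed.

Lemma finite_nat_bounded (A : set nat) :
  finite_set A -> exists n, forall x, A x -> x < n.
Proof.
move=> /finite_fsetP[X ->]; exists (\max_(x <- finmap.enum_fset X) x).+1 => x Xx.
by rewrite ltnS; apply: (@leq_bigmax_seq _ _ _ id).
Qed.

(* The values are corrected one argument at a time by composing with a
   transposition, which does not disturb the values already correct. *)
Lemma Sinf_extend (A : set nat) (f : pinj) :
  finite_set (dom f) -> dom f `<=` A -> im f `<=` A ->
  exists2 g, Sinf A g & f = pmul g (pid (dom f)).
Proof.
move=> /finite_nat_bounded[n fn] fA Af.
suff [g Sg gf] : exists2 g, Sinf A g &
    forall x y, x < n -> f x = Some y -> g x = Some y.
  exists g => //; apply: pinj_eqP => x z; split=> [fx|].
    have dx : dom f x by exists z.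
    by apply/pmulE; exists x; [exact/pidE|exact: gf (fn _ dx) fx].
  move=> /pmulE[y /pidE[dx <-]]; have [t ft] := dx.
  by rewrite ft (gf _ _ (fn _ dx) ft).
elim: n {fn} => [|n [g Sg gf]]; first by exists (pid A); [exact: Sinf_pid|].
case fn: (f n) => [b|]; last first.
  exists g => // x y; rewrite ltnS leq_eqVlt => /predU1P[->|xn]; last exact: gf.
  by rewrite fn.
have Ab : A b by apply: Af; exists n.
have [c Ac gn] : exists2 c, A c & g n = Some c.
  by apply: (Sinf_dom Sg); apply: fA; exists b.
exists (pmul (pswap A c b) g); first exact: Sinf_mul (Sinf_swap Ac Ab) Sg.
move=> x y; rewrite ltnS leq_eqVlt => /predU1P[->|xn].
  rewrite fn => -[<-]; apply/pmulE; exists c => //; apply/pswapE; split=> //.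
  by rewrite /swap eqxx.
move=> fx; have gx := gf _ _ xn fx; apply/pmulE; exists y => //; apply/pswapE.
split; first by apply: Af; exists x.
rewrite /swap; case: eqP => [yc|_].
  by have := pfun_inj gx; rewrite yc => /(_ _ gn) xn'; rewrite xn' ltnn in xn.
case: eqP => // yb.
by have := pfun_inj fx; rewrite yb => /(_ _ fn) xn'; rewrite xn' ltnn in xn.
Qed.

(** * Generated subsemigroups and the extended supremum *)

Lemma inv_subsemigroup_gen_closed (G : set pinj) :
  inv_subsemigroup (inv_subsemigroup_gen G).
Proof.
split=> [f g Sf Sg M MG|f Sf M MG].
  by apply: MG.1.1; [exact: Sf|exact: Sg].
by apply: MG.1.2; exact: Sf.
Qed.

(** A nonempty initial segment of the naturals either is everything, or is bounded and contains its
    supremum. *)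
Lemma esupE (M : set nat) k : M 0 -> (forall m n, m <= n -> M n -> M m) ->
  le_enat k (esup M) <-> M k.
Proof.
move=> M0 Mle.
have ubk j : ~ M j -> ubound M j.-1.
  move=> nMj m Mm; rewrite Order.NatOrder.leEnat; case: j nMj => // j nMj /=.
  by rewrite leqNgt; apply/negP => jm; apply: nMj; exact: Mle jm Mm.
rewrite /esup; case: pselect => [ubM|nub] /=; last first.
  by split=> // _; apply: contrapT => /ubk ub; apply: nub; exists k.-1.
have sM := nat_supremums_neq0 ubM.
split=> [ks|Mk]; last by have := ge_supremum_Nmem 0 sM Mk.
apply: contrapT => nMk.
have k0 : 0 < k by case: k nMk {ks}.
(* As [k] is outside [M], the supremum is at most [k.-1], which is less than [k] because [M 0] makes
   [k] positive. *)
suff : k <= k.-1 by rewrite -ltnS prednK // ltnn.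
apply: leq_trans ks _; rewrite /supremum ifF; last first.
  by apply/negP => /eqP MN; move: M0; rewrite MN.
have [_ +] := xgetPex 0 sM; apply; exact: ubk.
Qed.

(** * Chains as paths in a graph on the indices *)

Section AlmostDisjoint.
Variable B : nat -> set nat.
Hypothesis Binf : forall i, infinite_set (B i).
Hypothesis Bdisj : almost_disjoint B.

Let S := inv_subsemigroup_gen (\bigcup_i Sinf (B i)).

(** The edge relation of the graph. Every vertex carries a loop, since [B i] is infinite; this is
    why a chain from [i] to [i] needs a side condition. *)
Definition adj (m i j : nat) : bool := `I_m #<= B i `&` B j.

Definition reach (m i j : nat) : Prop :=
  exists2 s, path (adj m) i s & last i s = j.

(* The existence of an m-chain, with the side condition of the case [i = j]
   replaced by one which is uniform in [i] and [j]. *)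
Definition linked (m i j : nat) : Prop :=
  reach m i j /\ exists2 k, i <> k & adj m i k.

Lemma adjC m i j : adj m i j = adj m j i.
Proof. by rewrite /adj setIC. Qed.

Lemma adjxx m i : adj m i i.
Proof.
rewrite /adj setIid; apply: (@card_le_trans _ _ _ [set: nat]); last exact/infiniteP.
exact: card_leT.
Qed.

Lemma adj_le m n i j : m <= n -> adj n i j -> adj m i j.
Proof. by rewrite -card_le_II => mn; exact: card_le_trans. Qed.

Lemma reachxx m i : reach m i i.
Proof. by exists [::]. Qed.

Lemma reach_trans m i j k : reach m i j -> reach m j k -> reach m i k.
Proof.
move=> [s ps <-] [t pt <-]; exists (s ++ t); last by rewrite last_cat.
by rewrite cat_path ps.
Qed.

Lemma adj_reach m i j : adj m i j -> reach m i j.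
Proof. by move=> ij; exists [:: j] => //=; rewrite ij. Qed.

Lemma reach_sym m i j : reach m i j -> reach m j i.
Proof.
move=> [s + <-]; elim: s i => [|k s IHs] i /=; first by move=> _; exact: reachxx.
move=> /andP[ik ks]; apply: reach_trans (IHs _ ks) _.
by apply: adj_reach; rewrite adjC.
Qed.

(** Once the initial loops at [i] are skipped, the next vertex of the path is a neighbour other than
    [i]. *)
Lemma reach_neq m i j : reach m i j -> i <> j -> exists2 k, i <> k & adj m i k.
Proof.
move=> [s + <-]; elim: s => [|k s IHs] //= /andP[ik ks].
by have [ki|/eqP ki] := eqVneq i k; [subst k; exact: IHs|exists k].
Qed.

Lemma linked_sym m i j : linked m i j -> linked m j i.
Proof.
move=> [rij [k ik aik]]; split; first exact: reach_sym.
have [->|/eqP ij] := eqVneq j i; first by exists k.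
exact: reach_neq (reach_sym rij) ij.
Qed.

Lemma chain_linked m i j : (exists ks, is_chain B m i j ks) <-> linked m i j.
Proof.
split=> [[[//|k s] [ps ik]]|[rij [k ik aik]]].
  have rij : reach m i j by exists (rcons (k :: s) j) => //; rewrite last_rcons.
  split=> //; have [ij|/eqP] := eqVneq i j; last exact: reach_neq.
  by exists k; [exact: ik|move: ps => /= /andP[]].
have [<-|/eqP ij] := eqVneq i j.
  have aki : adj m k i by rewrite adjC.
  (* The chain goes from [i] to its neighbour [k] and back. *)
  by exists [:: k]; split=> //=; rewrite -/(adj m i k) aik -/(adj m k i) aki.
have [s ps lst] := rij; case/lastP: s ps lst => [//|s l].
rewrite last_rcons => + lj; rewrite lj => ps.
(* The loop at [i] is put in front so that the tuple is nonempty even when [i] and [j] are joined by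
   a single edge. The side condition is void because [i] differs from [j]. *)
exists (i :: s); split; last by [].
by rewrite rcons_cons /=; apply/andP; split; [exact: adjxx|].
Qed.

Lemma linked_le m n i j : m <= n -> linked n i j -> linked m i j.
Proof.
move=> mn [[s ps sj] [k ik nik]]; split; last by exists k => //; exact: adj_le nik.
by exists s => //; apply: sub_path ps => a b; exact: adj_le.
Qed.

Lemma linked0 i j : linked 0 i j.
Proof.
have a0 a b : adj 0 a b by rewrite /adj II0.
split; first exact: adj_reach.
by exists i.+1 => // /eqP; rewrite -[X in X == _]addn0 -addn1 eqn_add2l.
Qed.

(** The values [m] admitting a chain are closed downwards and include 0, so [esupE] removes the
    supremum from the rest of the proof. *)
Lemma le_chain_sup k i j : le_enat k (chain_sup B i j) <-> linked k i j.
Proof.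
rewrite /chain_sup esupE; first exact: chain_linked.
  exact/chain_linked/linked0.
by move=> m n mn /chain_linked l; apply/chain_linked; exact: linked_le l.
Qed.

(** * The generated subsemigroup and a uniform form of the right-hand side *)

Lemma S_mul f g : S f -> S g -> S (pmul f g).
Proof. exact: (inv_subsemigroup_gen_closed _).1. Qed.

Lemma S_inv f : S f -> S (pinv f).
Proof. exact: (inv_subsemigroup_gen_closed _).2. Qed.

Lemma S_Sinf i f : Sinf (B i) f -> S f.
Proof. by move=> Sf; apply: sub_smallest; [exact: subset_refl|exists i]. Qed.

(** Merges the sets [Ik] with the empty map: quantifying over all [m] up to the size of the domain
    avoids naming that size, and size 0 imposes nothing by [linked0]. *)
Definition finite_linked (f : pinj) : Prop :=
  finite_set (dom f) /\ exists i j,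
    [/\ dom f `<=` B i, im f `<=` B j &
        forall m, `I_m #<= dom f -> linked m i j].

Lemma union_finite_linkedE :
  (\bigcup_i Sinf (B i))
    `|` (\bigcup_i \bigcup_j
           \bigcup_(k in [set k | 1 <= k /\ le_enat k (chain_sup B i j)])
             Ik k (B i) (B j))
    `|` [set pempty]
  = (\bigcup_i Sinf (B i)) `|` finite_linked.
Proof.
rewrite -setUA; congr (_ `|` _); apply/seteqP; split=> f.
  move=> [[i _ [j _ [k [k1 /le_chain_sup kij] [fi fj fk]]]]|->].
    split; first by exists k.
    exists i, j; split=> // m; rewrite (card_le_eqr fk) card_le_II => mk.
    exact: linked_le kij.
  have d0 : dom pempty = set0 by apply/seteqP; split=> // x [].
  split; first by rewrite d0; exact: finite_set0.
  exists 0, 0; split; [by move=> x []|by move=> x []|].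
  move=> m; rewrite d0 -(@II0) card_le_II leqn0 => /eqP ->; exact: linked0.
move=> [[[|k] fk] [i [j [fi fj lf]]]]; last first.
  left; exists i => //; exists j => //; exists k.+1 => //; split=> //.
  by apply/le_chain_sup/lf; rewrite (card_le_eqr fk).
right; apply: pinj_ext => x; case fx: (f x) => [y|//].
move: fk; rewrite II0 card_eq0 => /eqP d0.
have : dom f x by exists y.
by rewrite d0.
Qed.

(** * Closure of the right-hand side under product and inverse *)

(** A weakening of [finite_linked] that permutations of a single [B i] satisfy as well, so that one
    product lemma serves both kinds of factor. *)
Definition spans (f : pinj) i j : Prop :=
  [/\ dom f `<=` B i, im f `<=` B j & forall m, `I_m #<= dom f -> reach m i j].

Lemma finite_linked_spans f :
  finite_linked f -> exists i j, spans f i j.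
Proof.
move=> [_ [i [j [fi fj lf]]]]; exists i, j; split=> // m /lf; by case.
Qed.

Lemma Sinf_spans f i : Sinf (B i) f -> spans f i i.
Proof. by rewrite /spans => -[-> ->]; split=> // m _; exact: reachxx. Qed.

Lemma dom_mul_le f g : dom (pmul f g) #<= dom f.
Proof.
by apply: (@card_le_pinj g) => x [z /pmulE[y gx fy]]; exists y => //; exists z.
Qed.

Lemma dom_mul_sub f g : dom (pmul f g) `<=` dom g.
Proof. by move=> x [z /pmulE[y gx fy]]; exists y. Qed.

Lemma im_mul_sub f g : im (pmul f g) `<=` im f.
Proof. by move=> z [x /pmulE[y gx fy]]; exists y. Qed.

Lemma dom_mul_adj f g j j' :
  im g `<=` B j -> dom f `<=` B j' -> dom (pmul f g) #<= B j `&` B j'.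
Proof.
move=> gj fj'; apply: (@card_le_pinj g) => x [z /pmulE[y gx fy]].
by exists y => //; split; [apply: gj; exists x|apply: fj'; exists z].
Qed.

(** The size of the domain of the product is bounded by those of [dom g], of the intersection of
    [B j] and [B j'], and of [dom f]. These bounds give the path from [i] to [j], the edge to [j'],
    and the path on to [l]. *)
Lemma spans_mul f g i j j' l : spans g i j -> spans f j' l -> spans (pmul f g) i l.
Proof.
move=> [gi gj gr] [fj fl fr]; split.
- exact: subset_trans (@dom_mul_sub f g) gi.
- exact: subset_trans (@im_mul_sub f g) fl.
move=> m mfg; apply: (@reach_trans _ _ j).
  by apply: gr; apply: card_le_trans mfg (subset_card_le (@dom_mul_sub f g)).
apply: (@reach_trans _ _ j').
  by apply: adj_reach; exact: card_le_trans mfg (dom_mul_adj gj fj).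
by apply: fr; exact: card_le_trans mfg (dom_mul_le f g).
Qed.

Lemma finite_linked_inv f : finite_linked f -> finite_linked (pinv f).
Proof.
move=> [fin [i [j [fi fj lf]]]]; have c := card_dom_im f; split.
  by rewrite dom_pinv -(eq_finite_set c).
exists j, i; rewrite dom_pinv im_pinv; split=> // m.
by rewrite -(card_le_eqr c) => /lf; exact: linked_sym.
Qed.

(** The product starts at the same index [i] as [g], so it inherits the neighbour of [i] that
    [linked] demands. *)
Lemma finite_linked_mull f g j l :
  finite_linked g -> spans f j l -> finite_linked (pmul f g).
Proof.
move=> Lg sf; have [fin [i [k [gi gk lg]]]] := Lg; split.
  exact: sub_finite_set (@dom_mul_sub f g) fin.
have sg : spans g i k by split=> // m /lg[].
have [fgi fgl fgr] := spans_mul sg sf; exists i, l; split=> // m mfg.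
split; first exact: fgr.
have [] := lg m; last by [].
exact: card_le_trans mfg (subset_card_le (@dom_mul_sub f g)).
Qed.

Lemma pinv_pmul f g : pinv (pmul f g) = pmul (pinv g) (pinv f).
Proof.
apply: pinj_eqP => z x; split.
  move=> /pinv_funE /pmulE[y gx fy]; apply/pmulE.
  by exists y; apply/pinv_funE.
move=> /pmulE[y /pinv_funE fy /pinv_funE gx]; apply/pinv_funE/pmulE.
by exists y.
Qed.

Lemma pinvK f : pinv (pinv f) = f.
Proof.
apply: pinj_eqP => x y; split=> [/pinv_funE /pinv_funE//|fx].
by apply/pinv_funE/pinv_funE.
Qed.

Lemma spans_inv f i j : spans f i j -> spans (pinv f) j i.
Proof.
move=> [fi fj fr]; rewrite /spans dom_pinv im_pinv; split=> // m.
by rewrite -(card_le_eqr (card_dom_im f)) => /fr; exact: reach_sym.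
Qed.

(** Here the known neighbour sits at the far end; inversion reduces this to the previous case. *)
Lemma finite_linked_mulr f g j l :
  finite_linked f -> spans g j l -> finite_linked (pmul f g).
Proof.
move=> /finite_linked_inv Lf /spans_inv sg.
by rewrite -(pinvK (pmul f g)) pinv_pmul;
  exact: finite_linked_inv (finite_linked_mull Lf sg).
Qed.

Lemma Sinf_finite_linked_closed : inv_subsemigroup ((\bigcup_i Sinf (B i)) `|` finite_linked).
Proof.
split; last first.
  move=> f [[i _ Sf]|Lf]; first by left; exists i => //; exact: Sinf_inv.
  by right; exact: finite_linked_inv.
move=> f g [[i _ Sf]|Lf] [[j _ Sg]|Lg].
- have [ij|/eqP ij] := eqVneq i j.
    by left; exists i => //; apply: Sinf_mul Sf _; rewrite ij.
  have sf := Sinf_spans Sf; have sg := Sinf_spans Sg.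
  (* For distinct indices the finite intersection bounds the domain, which gives finiteness, and it
     also provides the neighbour [i] of [j]. *)
  have cji : dom (pmul f g) #<= B j `&` B i.
    by apply: dom_mul_adj; [rewrite Sg.2|rewrite Sf.1].
  have [fgj fgi fgr] := spans_mul sg sf.
  right; split.
    by apply: card_le_finite cji _; apply: Bdisj => ji; exact: ij.
  exists j, i; split=> // m mfg; split; first exact: fgr.
  by exists i; [move=> ji; exact: ij|exact: card_le_trans mfg cji].
- by right; apply: finite_linked_mull Lg (Sinf_spans Sf).
- by right; apply: finite_linked_mulr Lf (Sinf_spans Sg).
- have [i [j sg]] := finite_linked_spans Lg.
  by right; exact: finite_linked_mulr Lf sg.
Qed.

(** * Generation of idempotents and of linked finite bijections *)

(* Conjugating by the transposition of [a] with some [b] outside [D]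
   moves [a] out of [D]. *)
Lemma S_pid_remove i D a : finite_set D -> D `<=` B i -> S (pid D) ->
  S (pid (D `\ a)).
Proof.
move=> Dfin Di SD; have [Da|nDa] := pselect (D a); last first.
  by rewrite (_ : D `\ a = D) //; apply: not_setD1.
have [b [Bb nDb]] := infinite_setN0 (infinite_setD (@Binf i) Dfin).
pose t := pswap (B i) a b.
have St : S t by apply: (@S_Sinf i); apply: Sinf_swap => //; exact: Di.
suff -> : pid (D `\ a) = pmul (pmul t (pmul (pid D) t)) (pid D).
  exact: S_mul (S_mul St (S_mul SD St)) SD.
apply: pinj_eqP => x y; split.
  move=> /pidE[[Dx xa] <-].
  have sx : swap a b x = x.
    rewrite /swap; case: eqP => // _; case: eqP => // xb.
    by case: nDb; rewrite -xb.
  have tx : t x = Some x by apply/pswapE; split=> //; exact: Di.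
  apply/pmulE; exists x; first exact/pidE.
  by apply/pmulE; exists x => //; apply/pmulE; exists x => //; exact/pidE.
move=> /pmulE[_ /pidE[Dx <-]] /pmulE[w /pmulE[z /pswapE[_ sx] /pidE[Dz <-]]].
move=> /pswapE[_ <-]; rewrite -sx swapK; apply/pidE; split=> //; split=> // xa.
by apply: nDb; rewrite xa /swap eqxx in sx; rewrite sx.
Qed.

(** The points of [D] outside [C] are removed in increasing order: at stage [k] those below [k] are
    gone, so stage 0 is [D] and a stage bounding [D] is [C]. *)
Lemma S_pid_sub i D C : finite_set D -> D `<=` B i -> S (pid D) -> C `<=` D ->
  S (pid C).
Proof.
move=> Dfin Di SD CD; have [n Dn] := finite_nat_bounded Dfin.
have sub k : C `|` (D `&` [set x | k <= x]) `<=` D.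
  by move=> x [/CD//|[]].
suff /(_ n) : forall k, S (pid (C `|` (D `&` [set x | k <= x]))).
  rewrite (_ : D `&` _ = set0) ?setU0 //.
  by apply/seteqP; split=> // x [/Dn + /=]; rewrite ltnNge => /negP.
elim=> [|k IHk].
  rewrite (_ : _ `|` _ = D) //; apply/seteqP; split; first exact: sub.
  by move=> x Dx; right.
have [Ck|nCk] := pselect (C k).
  rewrite (_ : _ `|` _ = C `|` (D `&` [set x | k <= x])) //.
  apply/seteqP; split=> x [|[Dx /=]]; [by left|by right; split=> //; exact: ltnW|by left|].
  by rewrite leq_eqVlt => /predU1P[<-|]; [left|right].
rewrite (_ : _ `|` _ = (C `|` (D `&` [set x | k <= x])) `\ k).
  apply: S_pid_remove IHk; first exact: sub_finite_set (sub k) Dfin.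
  exact: subset_trans (sub k) Di.
apply/seteqP; split=> x.
  move=> [Cx|[Dx /= kx]]; first by split; [left|move=> xk; apply: nCk; rewrite -xk].
  split; first by right; split=> //; exact: ltnW.
  by move=> xk; rewrite xk ltnn in kx.
move=> [[Cx|[Dx /= kx]] xk]; first by left.
by right; split=> //=; rewrite ltn_neqAle kx andbT; apply/eqP => kx'; exact: xk.
Qed.

(** Some permutation [g] of [B i] carries [A] into the intersection, where the identity of the image
    of [A] is generated; conjugating that identity by [g] gives [pid A]. *)
Lemma S_pid_linked i k A : i <> k -> A `<=` B i -> A #<= B i `&` B k -> S (pid A).
Proof.
move=> ik Ai cA; have Ffin := Bdisj ik.
have SF : S (pid (B i `&` B k)).
  by rewrite -pmul_pid; apply: S_mul; [apply: (@S_Sinf i)|apply: (@S_Sinf k)];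
    exact: Sinf_pid.
have [h hA hF] := card_le_pinjP cA.
have Sh : S (pid (im h)).
  by apply: (@S_pid_sub i _ _ Ffin) => // x [].
have [g Sg hg] : exists2 g, Sinf (B i) g & h = pmul g (pid (dom h)).
  apply: Sinf_extend; rewrite ?hA //; first exact: card_le_finite cA Ffin.
  by move=> x /hF[].
suff -> : pid A = pmul (pinv g) (pmul (pid (im h)) g).
  have Sg' := S_Sinf Sg.
  by apply: S_mul (S_inv Sg') _; exact: S_mul.
apply: pinj_eqP => x y; split.
  move=> /pidE[Ax <-]; have [z hx] : dom h x by rewrite hA.
  have gx : g x = Some z.
    by move: hx; rewrite hg => /pmulE[_ /pidE[_ <-]].
  apply/pmulE; exists z; last exact/pinv_funE.
  by apply/pmulE; exists z => //; apply/pidE; split=> //; exists x.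
move=> /pmulE[w /pmulE[z gx /pidE[[u hu] <-]] /pinv_funE gy].
have yx := pfun_inj gy gx; subst y; apply/pidE; split=> //.
have gu : g u = Some z by move: hu; rewrite hg => /pmulE[_ /pidE[_ <-]].
by rewrite -(pfun_inj gu gx) -hA; exists z.
Qed.

(** Induction on the path: [h] moves [dom f] into the intersection of [B i] with the next set [B k],
    and [pmul f (pinv h)] continues from there. The idempotent on [dom f] cuts a permutation of
    [B i] down to [h], or to [f] itself when the path is empty. *)
Lemma S_path m i s f : path (adj m) i s -> finite_set (dom f) ->
  dom f #<= `I_m -> dom f `<=` B i -> im f `<=` B (last i s) ->
  S (pid (dom f)) -> S f.
Proof.
elim: s i f => [|k s IHs] i f /=.
  move=> _ fin _ fi fi' Sd; have [g Sg ->] := Sinf_extend fin fi fi'.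
  by apply: S_mul _ Sd; exact: S_Sinf Sg.
move=> /andP[ik ks] fin fm fi fl Sd.
have [h hf hik] := card_le_pinjP (card_le_trans fm ik).
have hd : finite_set (dom h) by rewrite hf.
have [g Sg hg] : exists2 g, Sinf (B i) g & h = pmul g (pid (dom h)).
  by apply: Sinf_extend => //; [rewrite hf|move=> x /hik[]].
have Sh : S h by rewrite hg; apply: S_mul; [exact: S_Sinf Sg|rewrite hf].
have fE : f = pmul (pmul f (pinv h)) h.
  apply: pinj_eqP => x y; split=> [fx|/pmulE[z hx /pmulE[w /pinv_funE hw fw]]].
    have [z hx] : dom h x by rewrite hf; exists y.
    by apply/pmulE; exists z => //; apply/pmulE; exists x => //; exact/pinv_funE.
  by rewrite (pfun_inj hx hw).
have dE : dom (pmul f (pinv h)) = im h.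
  apply/seteqP; split=> z.
    by move=> [y /pmulE[x /pinv_funE hx _]]; exists x.
  move=> [x hx]; have [y fx] : dom f x by rewrite -hf; exists z.
  by exists y; apply/pmulE; exists x => //; exact/pinv_funE.
have cE : im h #= dom f by rewrite card_eq_sym -hf; exact: card_dom_im.
rewrite fE; apply: S_mul => //; apply: (IHs k) => //; rewrite ?dE.
- by rewrite (eq_finite_set cE).
- by rewrite (card_le_eql cE).
- by move=> x /hik[].
- exact: subset_trans (@im_mul_sub _ _) fl.
(* The idempotent needed at the next step is on the new domain [im h], and [h] itself produces
   it. *)
suff -> : pid (im h) = pmul h (pinv h) by apply: S_mul => //; exact: S_inv.
apply: pinj_eqP => y z; split.
  move=> /pidE[[x hx] <-]; apply/pmulE; exists x => //; exact/pinv_funE.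
move=> /pmulE[x /pinv_funE hx hx']; apply/pidE; split; first by exists x.
by move: hx'; rewrite hx => -[].
Qed.

(** With [m] the exact size of the domain, the neighbour of [i] yields the idempotent on [dom f],
    and the path then yields [f]. *)
Lemma finite_linked_S f : finite_linked f -> S f.
Proof.
move=> [fin [i [j [fi fj lf]]]]; have [m fm] := fin.
have [|[s ps sj] [k ik aik]] := lf m; first by rewrite (card_le_eqr fm).
have fm' : dom f #<= `I_m by rewrite (card_le_eql fm).
apply: (S_path ps) => //; first by rewrite sj.
by apply: (S_pid_linked ik) => //; exact: card_le_trans aik.
Qed.

End AlmostDisjoint.

Theorem theorem4p11 (B : nat -> set nat) :
  (forall i, infinite_set (B i)) ->
  almost_disjoint B ->
  inv_subsemigroup_gen (\bigcup_i Sinf (B i)) =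
    (\bigcup_i Sinf (B i))
    `|` (\bigcup_i \bigcup_j
           \bigcup_(k in [set k | 1 <= k /\ le_enat k (chain_sup B i j)])
             Ik k (B i) (B j))
    `|` [set pempty].
Proof.
move=> Binf Bdisj; rewrite union_finite_linkedE //; apply/seteqP; split.
  by apply: smallest_sub; [exact: Sinf_finite_linked_closed|move=> f Sf; left].
by move=> f [[i _ Sf]|/finite_linked_S]; [exact: S_Sinf Sf|exact].
Qed.
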